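(* Let $(Z,\mathscr{J},\theta)$ be a complex contact manifold of complex dimension $2n+1\ge3$, and let $\pi_Q\colon Q\to Z$ be the $\mathrm{U}(1)$-principal bundle with the almost contact metric 3-structure $(g_Q,\Phi_\alpha,\xi_\alpha,\eta_\alpha)$, $\alpha=1,2,3$, associated with $(Z,\mathscr{J},\theta)$ as described in the context. Then for every $s=(a,b,c)\in S^2\subset\mathbb{R}^3$ there is an almost contact metric structure $(g_Q,\Phi_s,\xi_s,\eta_s)$ on $Q$, where $$\Phi_s=a\Phi_1+b\Phi_2+c\Phi_3,\qquad \xi_s=a\xi_1+b\xi_2+c\xi_3,\qquad \eta_s=a\eta_1+b\eta_2+c\eta_3 .$$ Moreover, setting $\nu_s(X,Y):=g_Q(\Phi_sX,Y)$, we have $$\eta_s\wedge(\nu_s)^{2n+1}=\eta_{s'}\wedge(\nu_{s'})^{2n+1}\neq0\qquad\text{for all } s,s'\in S^2 .$$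
   Context: Complex contact manifolds. A complex contact manifold $(Z,\mathscr{J},\theta)$ is a complex manifold $(Z,\mathscr{J})$ of complex dimension $2n+1\ge 3$ with an open cover $\{U_i\}$ and holomorphic 1-forms $\theta_i$ on $U_i$ such that $\theta_i\wedge(d\theta_i)^n$ vanishes nowhere on $U_i$, and $\theta_i=f_{ij}\theta_j$ on $U_i\cap U_j$ for holomorphic functions $f_{ij}\colon U_i\cap U_j\to\mathbb{C}^{\times}$. The cocycle $\{f_{ij}\}$ defines the contact line bundle $E$, and the $\theta_i$ define $\theta\in H^0(Z,\Omega^1_Z\otimes E)$. Put $L=E^{-1}$, with cocycle $g_{ij}=f_{ij}^{-1}$ and fibre coordinates $z_i$ satisfying $z_i=g_{ij}z_j$. With $\pi\colon L^\times=L\setminus\{\text{zero section}\}\to Z$ the projection, let $\vartheta$ be the global holomorphic 1-form on $L^\times$ with $\vartheta=z_i\,\pi^{\ast}\theta_i$ on $\pi^{-1}(U_i)$. For a Hermitian structure on $L$, $Q(L)$ is its unit circle bundle, a $\mathrm{U}(1)$-principal bundle over $Z$. Convention: for a 1-form $\eta$, $2\,d\eta(X,Y)=X(\eta(Y))-Y(\eta(X))-\eta([X,Y])$. For a $(1,1)$-tensor $\Phi$, $[\Phi,\Phi](X,Y)=\Phi^2[X,Y]+[\Phi X,\Phi Y]-\Phi[\Phi X,Y]-\Phi[X,\Phi Y]$. The tensor $\eta\otimes\xi$ is $X\mapsto\eta(X)\xi$. Almost contact structures. An almost contact structure is a triple $(\Phi,\xi,\eta)$ (a $(1,1)$-tensor,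 a vector field, a 1-form) with $\Phi\circ\Phi=-\mathrm{Id}+\eta\otimes\xi$, $\eta(\xi)=1$; it is normal if $[\Phi,\Phi]+2\,d\eta\otimes\xi=0$. A Riemannian metric $g$ is compatible if $g(\xi,X)=\eta(X)$ and $g(\Phi X,\Phi Y)=g(X,Y)-\eta(X)\eta(Y)$; then $(g,\Phi,\xi,\eta)$ is an almost contact metric structure. $(g,\Phi,\xi,\eta)$ is a contact metric structure if $\eta$ is a contact form with characteristic vector field $\xi$ ($\eta(\xi)=1$, $\xi\lrcorner d\eta=0$), $\eta(X)=g(X,\xi)$, $\Phi\circ\Phi=-\mathrm{Id}+\eta\otimes\xi$ and $d\eta(X,Y)=g(\Phi X,Y)$. An almost contact 3-structure is a triple of almost contact structures $(\Phi_\alpha,\xi_\alpha,\eta_\alpha)$ such that for every cyclic permutation $(\alpha,\beta,\gamma)$ of $(1,2,3)$: $\Phi_\alpha\Phi_\beta-\eta_\beta\otimes\xi_\alpha=-\Phi_\beta\Phi_\alpha+\eta_\alpha\otimes\xi_\beta=\Phi_\gamma$, $\Phi_\alpha(\xi_\beta)=-\Phi_\beta(\xi_\alpha)=\xi_\gamma$, $\eta_\alpha\circ\Phi_\beta=-\eta_\beta\circ\Phi_\alpha=\eta_\gamma$. An almost contact metric 3-structure is an almost contact 3-structure with one Riemannian metric compatible with all three structures. The associated structure. Given a Hermitian structure on $L$, the structure associated with $(Z,\mathscr{J},\theta)$ is an almost contact metric 3-structure $(g_Q,\Phi_\alpha,\xi_\alpha,\eta_\alpha)$ on $Q=Q(L)$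 such that: $\eta_2=\mathfrak{Re}(\vartheta)|_Q$, $\eta_3=\mathfrak{Im}(\vartheta)|_Q$; $\sqrt{-1}\,\eta_1$ is, up to a nonzero real constant factor, a principal connection 1-form on $Q$, $\xi_1$ is the constant multiple of the generator of the $\mathrm{U}(1)$-action with $\eta_1(\xi_1)=1$, and $\Phi_1(X)$ is the horizontal lift (with respect to $\ker\eta_1$) of $\mathscr{J}(\pi_{Q\ast}X)$; $g_Q=\pi_Q^\ast g_Z+\eta_1\otimes\eta_1$ for a Hermitian metric $g_Z$ on $Z$; and the following hold: (1) $(\Phi_1,\xi_1,\eta_1)$ is normal, the leaves of the foliation generated by $\xi_1$ are the fibres of $\pi_Q$, and $\mathscr{L}_{\xi_1}g_Q=0$; (2) $\eta_2,\eta_3$ are contact structures with $\eta_2\wedge(d\eta_2)^{2n+1}=\eta_3\wedge(d\eta_3)^{2n+1}\neq0$; (3) $(g_Q,\Phi_\alpha,\xi_\alpha,\eta_\alpha)$ is a contact metric structure for $\alpha=2,3$. Such a structure exists. *)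

(* Defs.v *)
From HB Require Import structures.
From mathcomp Require Import all_boot all_order all_algebra all_fingroup.
From mathcomp Require Import complex.
From mathcomp Require Import all_classical all_reals all_analysis.

Set Implicit Arguments.
Unset Strict Implicit.
Unset Printing Implicit Defensive.

Import Order.TTheory GRing.Theory Num.Theory numFieldNormedType.Exports.

Local Open Scope classical_set_scope.
Local Open Scope ring_scope.

Section Wedge.
Variables (K : numFieldType) (V : Type).

(* A form of degree [p] is a function of [p] vectors.  The wedge product is
   normalised by [1 / (p + q)!], as goes with the factor 2 in
   [2 d eta (X, Y) = X (eta Y) - Y (eta X) - eta [X, Y]]. *)
Definition wedge p q (w : ('I_p -> V) -> K) (w' : ('I_q -> V) -> K) :
    ('I_(p + q) -> V) -> K :=
  fun v => ((p + q)`!%:R)^-1 * \sum_(s : 'S_(p + q)) (-1) ^+ s *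
    w (fun i => v (s (lshift q i))) * w' (fun j => v (s (rshift p j))).

Fixpoint wedge_pow (w : ('I_2 -> V) -> K) k : ('I_(k * 2) -> V) -> K :=
  if k is k'.+1 then wedge w (@wedge_pow w k') else fun=> 1.

Definition of_form1 (w : V -> K) : ('I_1 -> V) -> K := fun v => w (v ord0).

Definition of_form2 (w : V -> V -> K) : ('I_2 -> V) -> K :=
  fun v => w (v ord0) (v ord_max).

(* [eta /\ nu ^ k] *)
Definition form1_wedge_pow (eta : V -> K) (nu : V -> V -> K) k :
    ('I_(1 + k * 2) -> V) -> K :=
  wedge (of_form1 eta) (@wedge_pow (of_form2 nu) k).

End Wedge.

Arguments form1_wedge_pow {K V} eta nu k v.

Section Smooth.
Variables (R : realType) (V W : normedModType R).

Fixpoint continuously_differentiable k (U : set V) (f : V -> W) : Prop :=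
  if k is k'.+1 then
    (forall x, U x -> differentiable f x) /\
    (forall v, continuously_differentiable k' U (fun x => 'D_v f x))
  else forall x, U x -> {for x, continuous f}.

Definition smooth_on (U : set V) (f : V -> W) : Prop :=
  forall k, continuously_differentiable k U f.

End Smooth.

(* Only used for open [U]: a function of several complex variables is
   holomorphic iff it is complex differentiable at each point. *)
Definition holomorphic_on (R : realType) (V W : normedModType R[i])
    (U : set V) (f : V -> W) : Prop :=
  forall x, U x -> differentiable f x.

(* A chart is given by its inverse, a parametrization [cpar a] of a piece of
   [M] by the set [cdom a] of coordinates.  The space carrying the atlas is the
   union of the images of the charts, a subset of the ambient type [M]. *)
Record atlas (K : numFieldType) (m : nat) (M : Type) := Atlas {
  cidx : Type;
  cdom : cidx -> set 'rV[K]_m;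
  cpar : cidx -> 'rV[K]_m -> M }.

Definition cimg (K : numFieldType) m M (A : atlas K m M) (a : cidx A) : set M :=
  cpar a @` cdom a.

Definition coord (K : numFieldType) m M (A : atlas K m M) (a : cidx A) (p : M) :
    'rV[K]_m :=
  xget 0 (cdom a `&` cpar a @^-1` [set p]).

(* The charts are homeomorphisms onto open sets, which cover [Z]. *)
Definition topological_atlas (K : numFieldType) m (Z : topologicalType)
    (A : atlas K m Z) : Prop :=
  [/\ forall a : cidx A, open (cdom a) /\ set_inj (cdom a) (cpar a),
      forall (a : cidx A) (V : set 'rV[K]_m), V `<=` cdom a ->
        (open V <-> open (cpar a @` V)) &
      forall p : Z, exists a : cidx A, cimg a p].

(* The map [f] read in the charts [a] and [b], and its domain. *)
Definition local_rep (K : numFieldType) m k M N (A : atlas K m M)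
    (B : atlas K k N) (f : M -> N) (a : cidx A) (b : cidx B) :
    'rV[K]_m -> 'rV[K]_k :=
  coord b \o f \o cpar a.

Definition rep_dom (K : numFieldType) m k M N (A : atlas K m M)
    (B : atlas K k N) (f : M -> N) (a : cidx A) (b : cidx B) : set 'rV[K]_m :=
  [set x | cdom a x /\ cimg b (f (cpar a x))].

Definition tangent (K : numFieldType) m k M N (A : atlas K m M)
    (B : atlas K k N) (f : M -> N) (a : cidx A) (b : cidx B) (x : 'rV[K]_m) :
    'M[K]_(m, k) :=
  jacobian (local_rep f a b) x.

(* Tensor fields are given by their components in each chart.  Tangent vectors
   are row vectors: a covector [w] is evaluated as [v *m w], an endomorphism
   [F] acts by [v *m F], so composition of endomorphisms is reversed matrix
   product; a bilinear form [g] is evaluated as [u *m g *m v^T]. *)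
Section Tensors.
Variables (K : numFieldType) (m : nat) (M : Type) (A : atlas K m M).

Definition field_vec := cidx A -> 'rV[K]_m -> 'rV[K]_m.
Definition field_covec := cidx A -> 'rV[K]_m -> 'cV[K]_m.
Definition field_endo := cidx A -> 'rV[K]_m -> 'M[K]_m.
Definition field_bilin := cidx A -> 'rV[K]_m -> 'M[K]_m.

Definition ev1 (w : 'cV[K]_m) (v : 'rV[K]_m) : K := (v *m w) 0 0.
Definition ev2 (g : 'M[K]_m) (u v : 'rV[K]_m) : K := (u *m g *m v^T) 0 0.
Definition appl (F : 'M[K]_m) (v : 'rV[K]_m) : 'rV[K]_m := v *m F.

Definition covec_compat (U : set M) (w : field_covec) : Prop :=
  forall a b x, rep_dom id a b x -> U (cpar a x) ->
    w a x = tangent id a b x *m w b (local_rep id a b x).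

Definition vec_compat (X : field_vec) : Prop :=
  forall a b x, rep_dom id a b x ->
    X b (local_rep id a b x) = X a x *m tangent id a b x.

Definition endo_compat (F : field_endo) : Prop :=
  forall a b x, rep_dom id a b x ->
    F a x *m tangent id a b x = tangent id a b x *m F b (local_rep id a b x).

Definition bilin_compat (g : field_bilin) : Prop :=
  forall a b x, rep_dom id a b x ->
    g a x = tangent id a b x *m g b (local_rep id a b x) *m (tangent id a b x)^T.

End Tensors.

Section Calculus.
Variables (K : numFieldType) (m : nat).
Implicit Types (X Y : 'rV[K]_m -> 'rV[K]_m) (w : 'rV[K]_m -> 'cV[K]_m).

(* [2 d w (X, Y) = X (w Y) - Y (w X) - w [X, Y]] at constant fields
   [X = u], [Y = v]. *)
Definition dext w (x u v : 'rV[K]_m) : K :=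
  2^-1 * ('D_u (fun y => ev1 (w y) v) x - 'D_v (fun y => ev1 (w y) u) x).

Definition lie_bracket X Y (x : 'rV[K]_m) : 'rV[K]_m :=
  'D_(X x) Y x - 'D_(Y x) X x.

Definition nijenhuis (F : 'rV[K]_m -> 'M[K]_m) X Y (x : 'rV[K]_m) : 'rV[K]_m :=
  let FX := fun y => appl (F y) (X y) in
  let FY := fun y => appl (F y) (Y y) in
  appl (F x) (appl (F x) (lie_bracket X Y x)) + lie_bracket FX FY x
  - appl (F x) (lie_bracket FX Y x) - appl (F x) (lie_bracket X FY x).

Definition lie_derivative_bilin X (g : 'rV[K]_m -> 'M[K]_m)
    (Y Y' : 'rV[K]_m -> 'rV[K]_m) (x : 'rV[K]_m) : K :=
  'D_(X x) (fun y => ev2 (g y) (Y y) (Y' y)) x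
  - ev2 (g x) (lie_bracket X Y x) (Y' x)
  - ev2 (g x) (Y x) (lie_bracket X Y' x).

End Calculus.

Section AlmostContact.
Variables (R : realType) (m : nat) (M : Type) (A : atlas R m M).
Implicit Types (Phi : field_endo A) (xi : field_vec A) (eta : field_covec A).
Implicit Types (g : field_bilin A).

Definition is_vector_field xi :=
  (forall a, smooth_on (cdom a) (xi a)) /\ vec_compat xi.
Definition is_one_form eta :=
  (forall a, smooth_on (cdom a) (eta a)) /\ covec_compat setT eta.
Definition is_endo_field Phi :=
  (forall a, smooth_on (cdom a) (Phi a)) /\ endo_compat Phi.

Definition riemannian_metric g : Prop :=
  [/\ forall a, smooth_on (cdom a) (g a),
      bilin_compat g,
      forall a x, cdom a x -> forall u v, ev2 (g a x) u v = ev2 (g a x) v u &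
      forall a x, cdom a x -> forall v, v != 0 -> 0 < ev2 (g a x) v v].

Definition almost_contact Phi xi eta : Prop :=
  [/\ is_endo_field Phi, is_vector_field xi, is_one_form eta,
      forall a x, cdom a x -> forall v,
        appl (Phi a x) (appl (Phi a x) v) = - v + ev1 (eta a x) v *: xi a x &
      forall a x, cdom a x -> ev1 (eta a x) (xi a x) = 1].

Definition compatible_metric g Phi xi eta : Prop :=
  forall a x, cdom a x ->
    (forall v, ev2 (g a x) (xi a x) v = ev1 (eta a x) v) /\
    (forall u v, ev2 (g a x) (appl (Phi a x) u) (appl (Phi a x) v) =
       ev2 (g a x) u v - ev1 (eta a x) u * ev1 (eta a x) v).

Definition almost_contact_metric g Phi xi eta : Prop :=
  [/\ almost_contact Phi xi eta, riemannian_metric g &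
      compatible_metric g Phi xi eta].

Definition normal Phi xi eta : Prop :=
  forall a (X Y : 'rV[R]_m -> 'rV[R]_m),
    smooth_on (cdom a) X -> smooth_on (cdom a) Y ->
    forall x, cdom a x ->
      nijenhuis (Phi a) X Y x + (2 * dext (eta a) x (X x) (Y x)) *: xi a x = 0.

(* [eta /\ (d eta) ^ k] at the point of coordinates [x] in the chart [a] *)
Definition contact_volume eta k (a : cidx A) (x : 'rV[R]_m) :
    ('I_(1 + k * 2) -> 'rV[R]_m) -> R :=
  form1_wedge_pow (ev1 (eta a x)) (dext (eta a) x) k.
Arguments contact_volume eta k a x v : clear implicits.

Definition contact_form k eta : Prop :=
  is_one_form eta /\
  forall a x, cdom a x -> exists v, contact_volume eta k a x v != 0.

(* [k] is such that the dimension is [2 * k + 1]. *)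
Definition contact_metric k g Phi xi eta : Prop :=
  [/\ riemannian_metric g /\ is_endo_field Phi, is_vector_field xi,
      contact_form k eta,
      forall a x, cdom a x -> ev1 (eta a x) (xi a x) = 1 /\
        forall v, dext (eta a) x (xi a x) v = 0 &
      forall a x, cdom a x ->
        [/\ forall v, ev1 (eta a x) v = ev2 (g a x) v (xi a x),
            forall v, appl (Phi a x) (appl (Phi a x) v) =
              - v + ev1 (eta a x) v *: xi a x &
            forall u v, dext (eta a) x u v = ev2 (g a x) (appl (Phi a x) u) v]].

Definition killing g xi : Prop :=
  forall a (Y Y' : 'rV[R]_m -> 'rV[R]_m),
    smooth_on (cdom a) Y -> smooth_on (cdom a) Y' ->
    forall x, cdom a x -> lie_derivative_bilin (xi a) (g a) Y Y' x = 0.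

Definition integral_curve xi (gam : R -> M) (lo hi : R) : Prop :=
  forall s, lo < s < hi -> exists (a : cidx A) (y : R -> 'rV[R]_m),
    (\forall r \near s, cdom a (y r) /\ cpar a (y r) = gam r) /\
    is_derive s 1 y (xi a (y s)).

Definition same_leaf xi (q q' : M) : Prop :=
  exists (gam : R -> M) (lo hi s s' : R),
    [/\ integral_curve xi gam lo hi, lo < s < hi, lo < s' < hi,
        gam s = q & gam s' = q'].

End AlmostContact.

Arguments contact_volume {R m M A} eta k a x v.

(* The indices 1, 2, 3 are the elements 0, 1, 2 of ['I_3 = Z/3], so that
   [(al, al + 1, al + 2)] runs over the cyclic permutations. *)
Section ThreeStructure.
Variables (R : realType) (m : nat) (M : Type) (A : atlas R m M).
Variables (Phi : 'I_3 -> field_endo A) (xi : 'I_3 -> field_vec A).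
Variable eta : 'I_3 -> field_covec A.

Definition almost_contact_3structure : Prop :=
  (forall al, almost_contact (Phi al) (xi al) (eta al)) /\
  forall (al : 'I_3) (be := al + 1) (ga := al + 2) a x, cdom a x ->
    let F i := appl (Phi i a x) in
    let e i := ev1 (eta i a x) in
    let z i := xi i a x in
    [/\ forall v, F al (F be v) - e be v *: z al = F ga v,
        forall v, - F be (F al v) + e al v *: z be = F ga v,
        F al (z be) = z ga /\ - F be (z al) = z ga &
        forall v, e al (F be v) = e ga v /\ - e be (F al v) = e ga v].

Definition almost_contact_metric_3structure (g : field_bilin A) : Prop :=
  [/\ almost_contact_3structure, riemannian_metric g &
      forall al, compatible_metric g (Phi al) (xi al) (eta al)].

End ThreeStructure.

Section Complex.
Variable R : realType.
Local Notation C := R[i].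

(* [(x, y) |-> x + i y] *)
Definition cplx m (u : 'rV[R]_(m + m)) : 'rV[C]_m :=
  \row_j (u 0 (lshift m j) +i* u 0 (rshift m j))%C.

(* Multiplication by [i] read through [cplx] *)
Definition Jstd m : 'M[R]_(m + m) := block_mx 0 1%:M (- 1%:M) 0.

Definition realify m M (A : atlas C m M) : atlas R (m + m) M :=
  @Atlas R (m + m) M (cidx A) (fun a => @cplx m @^-1` cdom a)
    (fun a => cpar a \o @cplx m).

Definition complex_atlas m (Z : topologicalType) (A : atlas C m Z) : Prop :=
  topological_atlas A /\
  forall a b : cidx A, holomorphic_on (rep_dom id a b) (local_rep id a b).

Definition holomorphic_one_form m (Z : topologicalType) (A : atlas C m Z)
    (U : set Z) (w : field_covec A) : Prop :=
  (forall a, holomorphic_on (cdom a `&` cpar a @^-1` U) (w a)) /\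
  covec_compat U w.

Record complexContactManifold (n : nat) := ComplexContactManifold {
  ccm_space :> topologicalType;
  ccm_hausdorff : hausdorff_space ccm_space;
  ccm_second_countable : @second_countable ccm_space;
  ccm_atlas : atlas C n.*2.+1 ccm_space;
  ccm_complex : complex_atlas ccm_atlas;
  ccm_idx : Type;
  ccm_U : ccm_idx -> set ccm_space;
  ccm_open : forall i, open (ccm_U i);
  ccm_cover : forall p, exists i, ccm_U i p;
  ccm_theta : ccm_idx -> field_covec ccm_atlas;
  ccm_theta_hol : forall i, holomorphic_one_form (ccm_U i) (ccm_theta i);
  ccm_contact : forall i (a : cidx ccm_atlas) x,
    cdom a x -> ccm_U i (cpar a x) ->
    exists v, form1_wedge_pow (ev1 (ccm_theta i a x))
      (dext (ccm_theta i a) x) n v != 0;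
  ccm_f : ccm_idx -> ccm_idx -> ccm_space -> C;
  ccm_f_hol : forall i j (a : cidx ccm_atlas),
    holomorphic_on (W := (C : numFieldType))
      (cdom a `&` cpar a @^-1` (ccm_U i `&` ccm_U j))
      (ccm_f i j \o cpar a);
  ccm_f_neq0 : forall i j p, ccm_U i p -> ccm_U j p -> ccm_f i j p != 0;
  ccm_f_cocycle : forall i j k p, ccm_U i p -> ccm_U j p -> ccm_U k p ->
    ccm_f i j p * ccm_f j k p = ccm_f i k p;
  ccm_theta_f : forall i j (a : cidx ccm_atlas) x, cdom a x ->
    ccm_U i (cpar a x) -> ccm_U j (cpar a x) ->
    ccm_theta i a x = ccm_f i j (cpar a x) *: ccm_theta j a x }.

End Complex.

Section Bundles.
Variables (R : realType) (n : nat) (Z : complexContactManifold R n).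
Local Notation C := R[i].
Local Notation N := n.*2.+1.
Local Notation ZA := (ccm_atlas Z).
Local Notation ZR := (realify (ccm_atlas Z)).
Local Notation U := (@ccm_U R n Z).

Definition Lcocycle (i j : ccm_idx Z) (p : Z) : C := (ccm_f i j p)^-1.

(* A point of the line bundle [L] over [p] is the family of its fibre
   coordinates [z_i] for [p] in [U i], extended by 0 to the other indices. *)
Definition Ltot : Type := (Z * (ccm_idx Z -> C))%type.

Definition Lproj : Ltot -> Z := fst.
Definition fibre_coord (i : ccm_idx Z) (q : Ltot) : C := q.2 i.

Definition line_bundle : set Ltot := [set q |
  (forall i, ~ U i (Lproj q) -> fibre_coord i q = 0) /\
  (forall i j, U i (Lproj q) -> U j (Lproj q) ->
     fibre_coord i q = Lcocycle i j (Lproj q) * fibre_coord j q)].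

Definition line_point (i : ccm_idx Z) (p : Z) (z : C) : Ltot :=
  (p, fun j => if `[< U j p >] then Lcocycle j i p * z else 0).

(* Coordinates [(z_i, x)] on the part of [L^x] over [U i] *)
Definition Lx_atlas : atlas C (1 + N) Ltot :=
  @Atlas C (1 + N) Ltot (cidx ZA * ccm_idx Z)
    (fun e => [set w : 'rV[C]_(1 + N) |
       [/\ cdom e.1 (rsubmx w), U e.2 (cpar e.1 (rsubmx w)) &
           lsubmx w 0 0 != 0]])
    (fun e w => line_point e.2 (cpar e.1 (rsubmx w)) (lsubmx w 0 0)).

(* [z_i pi^* theta_i] *)
Definition vartheta : field_covec Lx_atlas :=
  fun e w => col_mx 0 (lsubmx w 0 0 *: ccm_theta e.2 e.1 (rsubmx w)).

(* The norm on [L] is given by [|l|^2 = h_i |z_i|^2] over [U i]. *)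
Record hermitianStructure := HermitianStructure {
  herm :> ccm_idx Z -> Z -> R;
  herm_gt0 : forall i p, U i p -> 0 < herm i p;
  herm_smooth : forall i (a : cidx ZR),
    smooth_on (cdom a `&` cpar a @^-1` U i) (herm i \o cpar a);
  herm_cocycle : forall i j p, U i p -> U j p ->
    herm j p = herm i p * Normc.normc (Lcocycle i j p) ^+ 2 }.

Definition expi (t : R) : C := (cos t +i* sin t)%C.

Section Circle.
Variable h : hermitianStructure.

Definition circle_bundle : set Ltot :=
  line_bundle `&` [set q | forall i, U i (Lproj q) ->
    h i (Lproj q) * Normc.normc (fibre_coord i q) ^+ 2 = 1].

(* Coordinates [(t, x)] with [z_i = h_i ^ (-1/2) exp (i t)] and [t] in
   [(t0, t0 + 2 pi)] on the part of [Q] over [U i] *)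
Definition circle_atlas : atlas R (1 + (N + N)) Ltot :=
  @Atlas R (1 + (N + N)) Ltot (cidx ZR * ccm_idx Z * R)
    (fun e => [set x : 'rV[R]_(1 + (N + N)) |
       [/\ cdom e.1.1 (rsubmx x), U e.1.2 (cpar e.1.1 (rsubmx x)) &
           e.2 < lsubmx x 0 0 < e.2 + 2 * pi]])
    (fun e x => let p := cpar e.1.1 (rsubmx x) in
       line_point e.1.2 p
         (((Num.sqrt (h e.1.2 p))^-1)%:C%C * expi (lsubmx x 0 0))).

Definition circle_act (u : C) (q : Ltot) : Ltot := (q.1, fun i => u * q.2 i).

(* The fundamental vector field of [i] in the Lie algebra [i R] of [U(1)] *)
Definition circle_generator : field_vec circle_atlas :=
  fun e x => 'D_1 (fun s : R => coord e (circle_act (expi s) (cpar e x))) 0.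

(* [i A] is a principal connection form. *)
Definition principal_connection (A : field_covec circle_atlas) : Prop :=
  [/\ is_one_form A,
      forall e x, cdom e x -> ev1 (A e x) (circle_generator e x) = 1 &
      forall u : C, Normc.normc u = 1 ->
        forall e e' x, rep_dom (circle_act u) e e' x ->
          A e x = tangent (circle_act u) e e' x *m
                  A e' (local_rep (circle_act u) e e' x)].

(* [vartheta] restricted to [Q], evaluated on the tangent vector [v] by means of
   the chart [e'] of [L^x] *)
Definition vartheta_restr (e : cidx circle_atlas)
    (e' : cidx (realify Lx_atlas)) (x v : 'rV[R]_(1 + (N + N))) : C :=
  ev1 (@vartheta e' (cplx (local_rep id e e' x)))
      (cplx (v *m tangent id e e' x)).

Definition hermitian_metric (gZ : field_bilin ZR) : Prop :=
  riemannian_metric gZ /\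
  forall a x, cdom a x -> forall u v,
    ev2 (gZ a x) (u *m Jstd R N) (v *m Jstd R N) = ev2 (gZ a x) u v.

Record associated_structure (gQ : field_bilin circle_atlas)
    (Phi : 'I_3 -> field_endo circle_atlas)
    (xi : 'I_3 -> field_vec circle_atlas)
    (eta : 'I_3 -> field_covec circle_atlas) : Prop := AssociatedStructure {
  as_3structure : almost_contact_metric_3structure Phi xi eta gQ;
  as_eta23 : forall e e' x, rep_dom id e e' x -> forall v,
    ev1 (eta 1 e x) v = complex.Re (vartheta_restr e e' x v) /\
    ev1 (eta 2 e x) v = complex.Im (vartheta_restr e e' x v);
  as_eta1 : exists k : R,
    k != 0 /\ principal_connection (fun e x => k *: eta 0 e x);
  as_xi1 : exists k : R,
    forall e x, cdom e x -> xi 0 e x = k *: circle_generator e x;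
  as_Phi1 : forall e (a : cidx ZR) x, rep_dom Lproj e a x -> forall v,
    ev1 (eta 0 e x) (appl (Phi 0 e x) v) = 0 /\
    appl (Phi 0 e x) v *m tangent Lproj e a x =
      (v *m tangent Lproj e a x) *m Jstd R N;
  as_metric : exists gZ : field_bilin ZR, hermitian_metric gZ /\
    forall e (a : cidx ZR) x, rep_dom Lproj e a x -> forall u v,
      ev2 (gQ e x) u v =
        ev2 (gZ a (local_rep Lproj e a x))
          (u *m tangent Lproj e a x) (v *m tangent Lproj e a x)
        + ev1 (eta 0 e x) u * ev1 (eta 0 e x) v;
  as_normal : normal (Phi 0) (xi 0) (eta 0);
  as_leaves : forall q q', circle_bundle q -> circle_bundle q' ->
    (same_leaf (xi 0) q q' <-> Lproj q = Lproj q');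
  as_killing : killing gQ (xi 0);
  as_contact2 : contact_form N (eta 1);
  as_contact3 : contact_form N (eta 2);
  as_volume : forall e x, cdom e x -> forall v,
    contact_volume (eta 1) N e x v = contact_volume (eta 2) N e x v;
  as_contact_metric2 : contact_metric N gQ (Phi 1) (xi 1) (eta 1);
  as_contact_metric3 : contact_metric N gQ (Phi 2) (xi 2) (eta 2) }.

End Circle.
End Bundles.

Lemma cplx_surj (R : realType) m (x : 'rV[R[i]]_m) : exists u, cplx u = x.
Proof.
exists (row_mx (\row_j complex.Re (x 0 j)) (\row_j complex.Im (x 0 j))).
by apply/rowP => j; rewrite mxE row_mxEl row_mxEr !mxE; case: (x 0 j).
Qed.

Lemma expi_surj (R : realType) (z : R[i]) : Normc.normc z = 1 -> exists t, expi t = z.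
Proof.
case: z => a b /= /(congr1 (fun y => y ^+ 2)).
rewrite sqr_sqrtr ?addr_ge0 ?sqr_ge0 // expr1n => ab1.
have a1 : -1 <= a <= 1.
  by rewrite -ler_norml -(@expr_le1 _ 2) // real_normK ?num_real // -ab1 lerDl sqr_ge0.
have b2 : 1 - a ^+ 2 = b ^+ 2 by rewrite -ab1 addrAC subrr add0r.
case: (lerP 0 b) => b0.
  by exists (acos a); rewrite /expi acosK // sin_acos // b2 sqrtr_sqr ger0_norm.
exists (- acos a); rewrite /expi cosN sinN acosK // sin_acos // b2 sqrtr_sqr.
by rewrite ltr0_norm // opprK.
Qed.

(* The charts of [circle_atlas] cover exactly the unit circle bundle. *)
Lemma circle_bundleE (R : realType) (n : nat) (Z : complexContactManifold R n)
    (h : hermitianStructure Z) :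
  circle_bundle h = \bigcup_(e in [set: cidx (circle_atlas h)]) cimg e.
Proof.
have f1 i p : ccm_U i p -> ccm_f i i p = 1.
  move=> Ui; apply: (mulfI (ccm_f_neq0 Ui Ui)); rewrite mulr1.
  exact: ccm_f_cocycle.
apply/seteqP; split => [[p l] [[l0 lg] /= lh]|q [] [[a i] t0] _ [x /= [ax Ui t0x] <-]].
  rewrite /Lproj /fibre_coord /= in l0 lg lh.
  have [i Ui] := ccm_cover p.
  have [[_ _ cov] _] := ccm_complex Z.
  have [a [x ax xp]] := cov p.
  have [u ux] := cplx_surj x.
  have hp : 0 < h i p := herm_gt0 h Ui.
  set r := Num.sqrt (h i p).
  have r0 : 0 < r by rewrite sqrtr_gt0.
  have [t tl] : exists t, expi t = (r%:C)%C * l i.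
    apply: expi_surj; rewrite Normc.normcM /= expr0n /= addr0 sqrtr_sqr gtr0_norm //.
    apply/eqP; rewrite -(@eqrXn2 _ 2) ?mulr_ge0 ?(ltW r0) //; last first.
      by case: (l i) => ? ?; rewrite sqrtr_ge0.
    by rewrite exprMn sqr_sqrtr ?(ltW hp) // lh // expr1n.
  exists ((a : cidx (realify (ccm_atlas Z))), i, t - pi) => //.
  exists (row_mx (const_mx t) u).
    rewrite /= row_mxKr row_mxKl mxE /= ux; split => //; first by rewrite xp.
    by rewrite gtrBl pi_gt0 mulr2n mulrDl mul1r addrA subrK ltrDl pi_gt0.
  rewrite /= row_mxKr row_mxKl mxE ux xp /line_point; congr pair.
  apply/funext => j; rewrite tl; case: asboolP => Uj; last by rewrite l0.
  rewrite (lg _ _ Uj Ui); congr (_ * _).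
  rewrite mulrA -rmorphM /= mulVf ?mul1r ?lt0r_neq0 //.
set p := cpar _ _ in Ui *.
set p' := (X in h i X).
have -> : p' = p by [].
set z := _ * expi _.
have hp : 0 < h i p := herm_gt0 h Ui.
split.
  split=> [j /= nUj|j k /= Uj Uk]; rewrite /fibre_coord /=; first by case: asboolP.
  do 2!(case: asboolP => // _).
  by rewrite mulrA /Lcocycle -invfM -(ccm_f_cocycle Uj Uk Ui) mulrC.
move=> j /= Uj; rewrite /fibre_coord /=; case: asboolP => // _.
have hz : h i p * Normc.normc z ^+ 2 = 1.
  rewrite /z Normc.normcM /= expr0n /= addr0 sqrtr_sqr cos2Dsin2 sqrtr1 mulr1.
  rewrite real_normK ?num_real // exprVn sqr_sqrtr ?(ltW hp) // mulfV //.
  by rewrite gt_eqF.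
have gg : Lcocycle i j p * Lcocycle j i p = 1.
  by rewrite /Lcocycle -invfM mulrC ccm_f_cocycle // f1 // invr1.
rewrite (herm_cocycle h Ui Uj) Normc.normcM exprMn mulrA -[X in X * _]mulrA.
by rewrite -exprMn -Normc.normcM gg Normc.normc1 expr1n mulr1.
Qed.

Section Sphere.
Variables (R : realType) (m : nat) (M : Type) (A : atlas R m M).

Definition unit_sphere : set 'rV[R]_3 := [set s | \sum_i s 0 i ^+ 2 = 1].

Definition lin3_endo (s : 'rV[R]_3) (Phi : 'I_3 -> field_endo A) : field_endo A :=
  fun e x => \sum_i s 0 i *: Phi i e x.
Definition lin3_vec (s : 'rV[R]_3) (xi : 'I_3 -> field_vec A) : field_vec A :=
  fun e x => \sum_i s 0 i *: xi i e x.
Definition lin3_covec (s : 'rV[R]_3) (eta : 'I_3 -> field_covec A) :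
    field_covec A :=
  fun e x => \sum_i s 0 i *: eta i e x.

(* [eta /\ nu ^ k] with [nu (X, Y) = g (Phi X, Y)] *)
Definition fundamental_volume (g : field_bilin A) (Phi : field_endo A)
    (eta : field_covec A) k (a : cidx A) (x : 'rV[R]_m) :
    ('I_(1 + k * 2) -> 'rV[R]_m) -> R :=
  form1_wedge_pow (ev1 (eta a x))
    (fun u v => ev2 (g a x) (appl (Phi a x) u) v) k.

End Sphere.

Arguments fundamental_volume {R m M A} g Phi eta k a x v.

(* Main.v *)
Require Import Defs.
From mathcomp Require Import all_boot all_order all_algebra all_fingroup.
From mathcomp Require Import complex.
From mathcomp Require Import all_classical all_reals all_analysis.
From mathcomp Require Import ring lra.
Import Order.TTheory GRing.Theory Num.Theory numFieldNormedType.Exports.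
Local Open Scope classical_set_scope.
Local Open Scope ring_scope.

(** At a point, the structure is an almost contact metric 3-structure on a single
    Euclidean vector space: the direct sum of the span of the three Reeb vectors
    and of a horizontal part on which [Phi_1, Phi_2, Phi_3] act as the imaginary
    quaternions.  For [a, b] in R^3 and [eta v := (eta_1 v, eta_2 v, eta_3 v)]
    the nine relations between the tensors amount to

      [Phi_a (Phi_b v) = - <a, b> v + Phi_(a x b) v + <b, eta v> xi_a],
      [Phi_a xi_b = xi_(a x b)],   [eta (Phi_a v) = a x eta v]

    (lemmas [endo_lin3_comp], [endo_reeb_lin3], [reeb_coords_endo]).  With [a = b]
    of length one, this and [endo_metric] are the axioms of an almost contact
    metric structure.  Smoothness of the combined tensors is a matter of linear
    combinations on the chart domains, which are open.

    The formulas are invariant under rotations of R^3.  For the half-turn about a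
    unit vector [u] this can be realised on the tangent space: the map [T_u]
    acting by [Phi_u] on the horizontal part and by the half-turn on the span of
    the Reeb vectors is an isometry which carries [(eta_s, nu_s)] to
    [(eta_s', nu_s')], where [s'] is the image of [s] under the half-turn
    ([half_turn_form], [half_turn_fundamental_form]).  Hence
    [eta_s' /\ nu_s'^k], pulled back by [T_u], is [eta_s /\ nu_s^k].

    Any two unit vectors are exchanged by a half-turn, so nonvanishing passes from
    one unit vector to all others; it holds for the second structure, where
    [nu_2 = d eta_2] and [eta_2] is a contact form.  Now [T_u] preserves the
    nonzero top form attached to [u] itself, and a linear map multiplies a top
    form by its determinant ([top_form_pullback]); therefore [det T_u = 1]
    ([det_half_turn_map]).  So pulling back by [T_u] does not change any top form,
    and all the forms [eta_s /\ nu_s^k] are equal ([volume_eq]). *)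

Set Implicit Arguments.
Unset Strict Implicit.
Unset Printing Implicit Defensive.

(** * Smooth maps on open sets *)

Lemma near_eq_differentiable (K : numFieldType) (V W : normedModType K)
    (f g : V -> W) (x : V) :
  (\near x, f x = g x) -> differentiable f x -> differentiable g x.
Proof.
move=> fg df.
have gE : g \o shift x = cst (g x) + 'd f x +o_ 0 id.
  apply/eqaddoP => _/posnumP[e].
  have fx : f x = g x by apply: nbhs_singleton fg.
  have /eqaddoP/(_ e%:num (gt0 _)) := diff_locally df.
  apply: filterS2; last by move: fg; rewrite (near_shift 0 x) subr0; exact: id.
  by move=> y /= fgy; rewrite !fctE /= fx fgy.
apply/diff_locallyP; rewrite (diff_unique (diff_continuous df) gE).
by split=> //; exact: diff_continuous.
Qed.

(** The derivative of a linear combination is known only on [U], so induction on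
    the order of differentiability has to replace a function by another one that
    agrees with it there; openness makes this harmless, since derivatives are
    local. *)
Lemma continuously_differentiable_eq (R : realType) (V W : normedModType R)
    (U : set V) k (f g : V -> W) :
  open U -> {in U, f =1 g} -> continuously_differentiable k U f ->
  continuously_differentiable k U g.
Proof.
move=> oU; have nearU (h h' : V -> W) x :
    {in U, h =1 h'} -> U x -> \near x, h x = h' x.
  move=> hh' Ux; have := open_nbhs_nbhs (conj oU Ux).
  by apply: filterS => y Uy; apply: hh'; rewrite inE.
elim: k f g => [|k IHk] f g fg /=.
  move=> cf x Ux; have fgx := nearU _ _ _ fg Ux.
  rewrite /prop_for /continuous_at -(fg x) ?inE//; apply: cvg_trans (cf x Ux).
  exact: near_eq_cvg fgx.
case=> df cdf; split=> [x Ux|v].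
  exact: near_eq_differentiable (nearU _ _ _ fg Ux) (df x Ux).
apply: (IHk (fun x => 'D_v f x)) (cdf v) => x; rewrite inE => Ux.
exact: near_eq_derive (nearU _ _ _ fg Ux).
Qed.

Lemma smooth_on_lincomb (R : realType) (V W : normedModType R) (U : set V) n
    (a : 'I_n -> R) (f : 'I_n -> V -> W) :
  open U -> (forall i, smooth_on U (f i)) ->
  smooth_on U (fun x => \sum_i a i *: f i x).
Proof.
move=> oU sf k; have {sf} : forall i, continuously_differentiable k U (f i).
  by move=> i; exact: sf.
have E (g : 'I_n -> V -> W) :
    (fun x => \sum_i a i *: g i x) = \sum_(i < n) (a i *: g i).
  by apply/funext => x; rewrite fct_sumE.
elim: k f => [|k IHk] f /= cf.
  move=> x Ux; apply: cvg_big => [|i _]; first exact: add_continuous.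
  by apply: cvgZl_tmp; exact: cf.
split=> [x Ux|v].
  rewrite E; apply: differentiable_sum => i; apply: differentiableZ.
  by have [df _] := cf i; exact: df.
apply: (@continuously_differentiable_eq _ _ _ _ _
  (fun x => \sum_i a i *: 'D_v (f i) x)) => //.
  move=> x; rewrite inE => Ux; have dfi i : derivable (f i) x v.
    by apply: diff_derivable; have [df _] := cf i; exact: df.
  rewrite E derive_sum => [|i]; last exact: derivableZ.
  by apply: eq_bigr => i _; rewrite deriveZ.
by apply: IHk => i; have [_] := cf i.
Qed.

Lemma cplx_continuous (R : realType) m :
  continuous (@cplx R m : _ -> 'rV[(R[i] : numFieldType)]_m).
Proof.
move=> x A /nbhs_ballP[e e0 eA]; apply/nbhs_ballP.
have eR : e = (complex.Re e)%:C%C by rewrite RRe_real // gtr0_real.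
have e0' : 0 < complex.Re e / 2 by rewrite divr_gt0 // -ltcR -eR.
exists (complex.Re e / 2) => //= y [_ xy].
apply: eA; split=> // i j; rewrite (ord1 i) !mxE.
have a := xy 0 (lshift m j); have b := xy 0 (rshift m j).
rewrite -ball_normE /= in a; rewrite -ball_normE /= in b.
rewrite -ball_normE /= [ltRHS]eR normc_def ltcR /=.
apply: (@le_lt_trans _ _ (`|x 0 (lshift m j) - y 0 (lshift m j)|
  + `|x 0 (rshift m j) - y 0 (rshift m j)|)); last first.
  by rewrite [ltRHS]splitr ltrD.
rewrite -[leRHS]ger0_norm ?addr_ge0// -sqrtr_sqr ler_sqrt ?sqr_ge0//.
rewrite [leRHS]sqrrD !real_normK ?num_real//.
by rewrite lerD2r lerDl mulrn_wge0 ?mulr_ge0.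
Qed.

(** The part of a chart of [Z] lying over [U i] is open because charts are
    homeomorphisms; the coordinates of the circle bundle add an open interval of
    angles. *)
Lemma open_circle_chart (R : realType) (n : nat)
    (Z : complexContactManifold R n) (h : hermitianStructure Z)
    (e : cidx (circle_atlas h)) : open (cdom e).
Proof.
case: e => [[a i] t0]; have [[ch oc _] _] := ccm_complex Z.
have [oa inja] := ch a.
pose D := @cdom _ _ _ (ccm_atlas Z) a; pose P := @cpar _ _ _ (ccm_atlas Z) a.
have oU : open (D `&` P @^-1` ccm_U i).
  apply/(oc a _ (@subIsetl _ _ _)).
  rewrite (_ : _ @` _ = P @` D `&` ccm_U i); last first.
    apply/seteqP; split=> [_ [x [ax ix] <-]|_ [[x ax <-] ix]]; last by exists x.
    by split=> //; exists x.
  by apply: openI; [apply/(oc a _ (@subset_refl _ _)) | exact: ccm_open].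
have crs : continuous (@rsubmx R 1 1 (n.*2.+1 + n.*2.+1) : _ -> 'rV[R]__).
  move=> x A /nbhs_ballP[e e0 eA]; apply/nbhs_ballP.
  by exists e => //= y [_ xy]; apply: eA; split=> // k l; rewrite !mxE.
have -> : cdom ((a, i, t0) : cidx (circle_atlas h)) =
   (@cplx R _ \o rsubmx) @^-1` (D `&` P @^-1` ccm_U i) `&`
   (fun x => x 0 (lshift _ 0)) @^-1` `]t0, t0 + 2 * pi[.
  apply/seteqP; split=> x /=; rewrite in_itv /= !mxE.
    by case.
  by case=> -[].
apply: openI.
  apply: (@open_comp 'rV[R]_(1 + (n.*2.+1 + n.*2.+1))
    'rV[(R[i] : numFieldType)]_(n.*2.+1)) oU => //.
  by move=> x _; apply: continuous_comp; [exact: crs | exact: cplx_continuous].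
apply: (@open_comp 'rV[R]_(1 + (n.*2.+1 + n.*2.+1)) R).
  by move=> x _; exact: coord_continuous.
exact: interval_open.
Qed.

(** * Top-degree forms and determinants *)

(** A form is multilinear iff it is a finite sum of products of one covector per
    slot.  This shape is closed under [wedge] by mere reindexing and expands
    in a basis by distributivity. *)
Definition multilinear_form (K : numFieldType) (p m : nat)
    (w : ('I_p -> 'rV[K]_m) -> K) : Prop :=
  exists (T : finType) (c : T -> K) (L : T -> 'I_p -> 'cV[K]_m),
    forall v, w v = \sum_t c t * \prod_i ev1 (L t i) (v i).

Lemma multilinear_form_expand (K : numFieldType) (p m : nat)
    (w : ('I_p -> 'rV[K]_m) -> K) : multilinear_form w ->
  forall v, w v = \sum_(f : {ffun 'I_p -> 'I_m})
    (\prod_i v i 0 (f i)) * w (fun i => delta_mx 0 (f i)).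
Proof.
move=> [T [c [L wE]]] v; rewrite wE.
under eq_bigr => t _.
  under eq_bigr => i _ do rewrite /ev1 mxE.
  rewrite bigA_distr_bigA mulr_sumr.
  over.
rewrite exchange_big; apply: eq_bigr => f _ /=; rewrite wE mulr_sumr.
apply: eq_bigr => t _; rewrite big_split /= mulrCA; congr (_ * (_ * _)).
by apply: eq_bigr => i _; rewrite /ev1 -rowE mxE.
Qed.

Definition alternating (K : numFieldType) (V : Type) (p : nat)
    (w : ('I_p -> V) -> K) : Prop :=
  forall (s : 'S_p) v, w (fun i => v (s i)) = (-1) ^+ s * w v.

(** In the expansion along the standard basis, alternation kills the maps [f] that
    are not injective and turns the permutations into the Leibniz formula. *)
Lemma top_form_pullback_square (K : numFieldType) (m : nat)
    (w : ('I_m -> 'rV[K]_m) -> K) :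
  multilinear_form w -> alternating w ->
  forall v, w v = \det (\matrix_(i, j) v i 0 j) * w (fun i => delta_mx 0 i).
Proof.
move=> ml alt v; rewrite (multilinear_form_expand ml v).
have noninj (f : {ffun 'I_m -> 'I_m}) : ~~ injectiveb f ->
    w (fun i => delta_mx 0 (f i)) = 0.
  case/injectivePn => i [j ij fij].
  have := alt (tperm i j) (fun k => delta_mx 0 (f k)).
  rewrite odd_tperm ij expr1 mulN1r /=.
  rewrite (_ : (fun k => _) = fun k => delta_mx 0 (f k)); last first.
    by apply/funext => k; case: tpermP => // ->; rewrite fij.
  by move/eqP; rewrite -addr_eq0 -mulr2n mulrn_eq0 /= => /eqP.
rewrite (bigID (fun f : {ffun 'I_m -> 'I_m} => injectiveb f)) /=.
rewrite [X in _ + X]big1 ?addr0; last by move=> f /noninj ->; rewrite mulr0.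
rewrite (reindex (@pval _)) /=; last first.
  pose in_Sm := insubd (1%g : 'S_m).
  by exists in_Sm => /= f Uf; first apply: val_inj; apply: insubdK.
rewrite /determinant mulr_suml; apply: eq_big => [s|s _]; first exact: (valP s).
have -> : w (fun i => delta_mx 0 (pval s i)) =
    (-1) ^+ s * w (fun i => delta_mx 0 i).
  by rewrite -(alt s); congr w; apply/funext => i; rewrite pvalE.
rewrite mulrA [X in X * _]mulrC; congr (_ * _ * _).
by apply: eq_bigr => i _; rewrite mxE -pvalE.
Qed.

(** The degree and the dimension are equal only propositionally in the
    application, hence the equation [p = m]. *)
Lemma top_form_pullback (K : numFieldType) (p m : nat)
    (w : ('I_p -> 'rV[K]_m) -> K) : p = m ->
  multilinear_form w -> alternating w ->
  forall (T : 'M[K]_m) v, w (fun i => v i *m T) = (\det T) * w v.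
Proof.
move=> pm; case: m / pm w => w ml alt T v.
rewrite (top_form_pullback_square ml alt).
rewrite (top_form_pullback_square ml alt v) mulrA [(\det T) * _]mulrC.
congr (_ * _).
rewrite -det_mulmx; congr (\det _); apply/matrixP => i j.
by rewrite !mxE; apply: eq_bigr => k _; rewrite mxE.
Qed.

Lemma wedge_alternating (K : numFieldType) (V : Type) p q
    (w : ('I_p -> V) -> K) (w' : ('I_q -> V) -> K) :
  alternating (wedge w w').
Proof.
move=> s v; rewrite /wedge mulrCA; congr (_ * _).
(* A permutation [s] of the arguments is absorbed by reindexing [t] as [t s^-1]. *)
rewrite (reindex_inj (mulIg s^-1%g)) /= mulr_sumr; apply: eq_bigr => t _.
rewrite odd_permM odd_permV signr_addb [(-1) ^+ t * _]mulrC !mulrA.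
congr (_ * _ * _).
  by congr w; apply/funext => i; rewrite permM permKV.
by congr w'; apply/funext => i; rewrite permM permKV.
Qed.

Lemma wedge_multilinear (K : numFieldType) (m p q : nat)
    (w : ('I_p -> 'rV[K]_m) -> K) (w' : ('I_q -> 'rV[K]_m) -> K) :
  multilinear_form w -> multilinear_form w' ->
  multilinear_form (wedge w w').
Proof.
move=> [T [c [L wE]]] [T' [c' [L' wE']]].
exists ({perm 'I_(p + q)} * (T * T'))%type.
(* A summand of the wedge product is given by a permutation [s] and a summand of
   each factor; slot [k] is fed to [w] or to [w'] according to the block that
   contains [s^-1 k]. *)
pose c2 (s : 'S_(p + q)) (u : T * T') : K :=
  ((p + q)`!%:R)^-1 * (-1) ^+ s * (c u.1 * c' u.2).
pose L2 (s : 'S_(p + q)) (u : T * T') k :=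
  match fintype.split ((s^-1)%g k) with
  | inl i => L u.1 i | inr j => L' u.2 j end.
exists (fun su => c2 su.1 su.2), (fun su => L2 su.1 su.2) => v; rewrite /wedge.
rewrite -(pair_bigA _ (fun s u => c2 s u * \prod_i ev1 (L2 s u i) (v i))) /=.
rewrite mulr_sumr; apply: eq_bigr => s _.
rewrite wE wE' -!mulrA big_distrlr /= pair_bigA !mulr_sumr /=.
apply: eq_bigr => u _; rewrite -!mulrA; congr (_ * (_ * _)).
rewrite (reindex_perm s) /= big_split_ord /=.
congr (_ * _); rewrite mulrCA; congr (_ * (_ * _));
  apply: eq_bigr => i _; rewrite /L2 permK.
  by rewrite (unsplitK (inl i)).
by rewrite (unsplitK (inr i)).
Qed.

Lemma wedge_pow_multilinear (K : numFieldType) (m k : nat) (G : 'M[K]_m) :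
  multilinear_form (wedge_pow (of_form2 (ev2 G)) (k := k)).
Proof.
elim: k => [|k IHk] /=.
  exists unit, (fun=> 1), (fun _ _ => 0) => v.
  by rewrite (big_pred1 tt) => [|[]//]; rewrite big_ord0 mulr1.
apply: (@wedge_multilinear K m 2 (k * 2) _ _ _ IHk).
(* [ev2 G x y] is the sum over [j] of [(x G)_j y_j]. *)
exists 'I_m, (fun=> 1),
  (fun j i => if i == ord0 then col j G else delta_mx j 0).
move=> v; rewrite /of_form2 /ev2 mxE; apply: eq_bigr => j _.
rewrite mul1r big_ord_recl big_ord1 /= /ev1 -colE !mxE.
congr (_ * _); first by apply: eq_bigr => i _; rewrite !mxE.
by congr (v _ _ _); apply/val_inj.
Qed.

Lemma form1_wedge_pow_multilinear (K : numFieldType) (m k : nat)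
    (E : 'cV[K]_m) (G : 'M[K]_m) :
  multilinear_form (form1_wedge_pow (ev1 E) (ev2 G) k).
Proof.
apply: (@wedge_multilinear K m 1 (k * 2)); last exact: wedge_pow_multilinear.
exists unit, (fun=> 1), (fun _ _ => E) => v.
by rewrite (big_pred1 tt) => [|[]//]; rewrite big_ord1 mul1r.
Qed.

Lemma wedge_pow_comp (K : numFieldType) (V W : Type) (T : V -> W)
    (nu : W -> W -> K) k (v : 'I_(k * 2) -> V) :
  wedge_pow (of_form2 nu) (k := k) (fun i => T (v i)) =
  wedge_pow (of_form2 (fun x y => nu (T x) (T y))) (k := k) v.
Proof.
elim: k v => [|k IHk] v //=; rewrite /wedge; congr (_ * _).
by apply: eq_bigr => s _; rewrite -IHk.
Qed.

Lemma form1_wedge_pow_comp (K : numFieldType) (V W : Type) (k : nat)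
    (T : V -> W) (eta : W -> K) (nu : W -> W -> K) (v : 'I_(1 + k * 2) -> V) :
  form1_wedge_pow eta nu k (fun i => T (v i)) =
  form1_wedge_pow (fun x => eta (T x)) (fun x y => nu (T x) (T y)) k v.
Proof.
rewrite /form1_wedge_pow /wedge; congr (_ * _).
apply: eq_bigr => s _; congr (_ * _).
exact: (@wedge_pow_comp K V W T nu k (fun j => v (s (rshift 1 j)))).
Qed.

(** * Half-turns of three-dimensional space *)

Lemma ord3_sumE (V : nmodType) (F : 'I_3 -> V) : \sum_i F i = F 0 + F 1 + F 2.
Proof.
rewrite !big_ord_recl big_ord0 addr0 addrA.
by congr (F _ + F _ + F _); apply/val_inj.
Qed.

Lemma ord3_ind (P : 'I_3 -> Prop) : P 0 -> P 1 -> P 2 -> forall i, P i.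
Proof.
move=> P0 P1 P2 [[|[|[|//]]] i3].
- by rewrite (_ : Ordinal i3 = 0)//; apply/val_inj.
- by rewrite (_ : Ordinal i3 = 1)//; apply/val_inj.
- by rewrite (_ : Ordinal i3 = 2)//; apply/val_inj.
Qed.

Lemma ord3_addE : ((1 + 1)%R = 2%R :> 'I_3) * ((1 + 2)%R = 0%R :> 'I_3)
  * ((2 + 1)%R = 0%R :> 'I_3) * ((2 + 2)%R = 1%R :> 'I_3).
Proof. by do !split; apply/val_inj. Qed.

Lemma ord3_eqE :
  ((0%R == 1%R :> 'I_3) = false) * ((0%R == 2%R :> 'I_3) = false) *
  ((1%R == 0%R :> 'I_3) = false) * ((1%R == 2%R :> 'I_3) = false) *
  ((2%R == 0%R :> 'I_3) = false) * ((2%R == 1%R :> 'I_3) = false).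
Proof. by []. Qed.

(** The vector of coordinates [a] in the frame [f], where [f] is the triple of
    endomorphisms, of Reeb vectors or of contact forms. *)
Local Notation lin3 a f := (\sum_i (a : 'rV[_]_3) 0 i *: f i).

Lemma lin3D (R : rcfType) (V : lmodType R) (f : 'I_3 -> V) (a b : 'rV[R]_3) :
  lin3 (a + b) f = lin3 a f + lin3 b f.
Proof. by rewrite -big_split; apply: eq_bigr => i _; rewrite mxE scalerDl. Qed.

Lemma lin3Z (R : rcfType) (V : lmodType R) (f : 'I_3 -> V) k (a : 'rV[R]_3) :
  lin3 (k *: a) f = k *: lin3 a f.
Proof. by rewrite scaler_sumr; apply: eq_bigr => i _; rewrite mxE scalerA. Qed.

Lemma lin3_delta (R : rcfType) (V : lmodType R) (f : 'I_3 -> V) j :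
  lin3 (delta_mx 0 j : 'rV[R]_3) f = f j.
Proof.
rewrite (bigD1 j) //= big1 ?addr0 => [|i ij]; rewrite mxE ?eqxx ?scale1r //.
by rewrite (negPf ij) scale0r.
Qed.

Definition dot {R : rcfType} (a b : 'rV[R]_3) : R := \sum_i a 0 i * b 0 i.

(** Indices live in Z/3, so the cyclic formula gives all three components. *)
Definition cross {R : rcfType} (a b : 'rV[R]_3) : 'rV[R]_3 :=
  \row_i (a 0 (i + 1) * b 0 (i + 2) - a 0 (i + 2) * b 0 (i + 1)).

(** The rotation by the angle pi about the unit vector [u]. *)
Definition half_turn {R : rcfType} (u a : 'rV[R]_3) : 'rV[R]_3 :=
  (2 * dot u a) *: u - a.

(** Reduces an identity between expressions in dot and cross products to
    polynomial identities in the coordinates. *)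
Ltac coords3 :=
  try apply/rowP; try (elim/ord3_ind);
  rewrite /half_turn /cross /dot ?ord3_sumE !(mxE, ord3_sumE, ord3_addE, add0r).

Lemma dotC (R : rcfType) (a b : 'rV[R]_3) : dot a b = dot b a.
Proof. by apply: eq_bigr => i _; rewrite mulrC. Qed.

Lemma crossvv (R : rcfType) (a : 'rV[R]_3) : cross a a = 0.
Proof. by apply/rowP; elim/ord3_ind; rewrite !mxE mulrC subrr. Qed.

Lemma dot_delta (R : rcfType) (c : 'rV[R]_3) i : dot c (delta_mx 0 i) = c 0 i.
Proof.
rewrite /dot (bigD1 i) //= big1 ?addr0 => [|j ji]; rewrite mxE eqxx.
  by rewrite eqxx mulr1.
by rewrite (negPf ji) mulr0.
Qed.

Lemma half_turn_dot (R : rcfType) (u a b : 'rV[R]_3) :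
  dot (half_turn u a) b = dot a (half_turn u b).
Proof. coords3; ring. Qed.

Lemma half_turn_axis (R : rcfType) (u : 'rV[R]_3) :
  dot u u = 1 -> half_turn u u = u.
Proof. by move=> u1; rewrite /half_turn u1 mulr1 scaler_nat mulr2n addrK. Qed.

(** Here and below an identity that needs [|u| = 1] is obtained from a polynomial
    identity with the defect [|u|^2 - 1] made explicit. *)
Lemma half_turnK (R : rcfType) (u a : 'rV[R]_3) :
  dot u u = 1 -> half_turn u (half_turn u a) = a.
Proof.
move=> u1; have : half_turn u (half_turn u a) =
    a + (4 * (dot u u - 1) * dot u a) *: u by coords3; ring.
by rewrite u1 subrr mulr0 mul0r scale0r addr0.
Qed.

Lemma cross_half_turn (R : rcfType) (u a b : 'rV[R]_3) : dot u u = 1 ->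
  cross (half_turn u a) (half_turn u b) = half_turn u (cross a b).
Proof.
move=> u1; have : cross (half_turn u a) (half_turn u b) =
    half_turn u (cross a b) + (2 * (1 - dot u u)) *: cross a b by coords3; ring.
by rewrite u1 subrr mulr0 scale0r addr0.
Qed.

(** On the span of the Reeb vectors [Phi_u] acts as [a |-> u x a]; this is what has
    to be added to it to get the half-turn about [u]. *)
Definition half_turn_correction {R : rcfType} (u a : 'rV[R]_3) : 'rV[R]_3 :=
  half_turn u a - cross u a.

(** The vertical part of the statement that the half-turn map intertwines [Phi_s]
    and [Phi_s'], see [half_turn_endo]. *)
Lemma half_turn_correction_cross (R : rcfType) (u s a : 'rV[R]_3) :
  dot u u = 1 ->
  dot u a *: half_turn u s + cross (half_turn u s) (half_turn_correction u a) =
  dot s a *: u + half_turn_correction u (cross s a).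
Proof.
move=> u1; rewrite /half_turn_correction.
have -> : cross (half_turn u s) (half_turn u a - cross u a) =
    cross (half_turn u s) (half_turn u a) - cross (half_turn u s) (cross u a).
  by coords3; ring.
rewrite cross_half_turn //.
have -> : dot u a *: half_turn u s + (half_turn u (cross s a) -
    cross (half_turn u s) (cross u a)) =
    dot s a *: u + (half_turn u (cross s a) - cross u (cross s a)) +
    (2 * (dot u u - 1) * dot u s) *: a by coords3; ring.
by rewrite u1 subrr mulr0 mul0r scale0r addr0.
Qed.

(** The vertical part of the statement that the half-turn map is an isometry, see
    [half_turn_isometry]. *)
Lemma half_turn_correction_dot (R : rcfType) (u a b : 'rV[R]_3) :
  dot u u = 1 ->
  dot (half_turn_correction u b) (cross u a)
  + dot (half_turn_correction u a) (cross u b)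
  + dot (half_turn_correction u a) (half_turn_correction u b) =
  dot u a * dot u b.
Proof.
move=> u1; apply/eqP; rewrite -subr_eq0; apply/eqP.
transitivity ((dot u u - 1) * (4 * (dot u a * dot u b) - dot a b)).
  by rewrite /half_turn_correction; coords3; ring.
by rewrite u1 subrr mul0r.
Qed.

(** The axis is the direction of [a + b], or any direction orthogonal to [a] when
    [b = - a]. *)
Lemma half_turn_exists (R : rcfType) (a b : 'rV[R]_3) :
  dot a a = 1 -> dot b b = 1 ->
  exists2 u, dot u u = 1 & half_turn u a = b.
Proof.
have unitize (c : 'rV[R]_3) : 0 < dot c c -> dot ((Num.sqrt (dot c c))^-1 *: c)
    ((Num.sqrt (dot c c))^-1 *: c) = 1.
  move=> c0; set k := Num.sqrt _.
  transitivity ((k ^+ 2)^-1 * dot c c).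
    by rewrite -exprVn; coords3; ring.
  by rewrite sqr_sqrtr ?ltW// mulVf ?gt_eqF.
(* A half-turn about the line of [c], without normalising [c]. *)
have scaled (c : 'rV[R]_3) : 0 < dot c c ->
    2 * dot c a *: c = dot c c *: (a + b) ->
    exists2 u, dot u u = 1 & half_turn u a = b.
  move=> c0 cE; exists ((Num.sqrt (dot c c))^-1 *: c); first exact: unitize.
  set k := Num.sqrt _.
  have -> : half_turn (k^-1 *: c) a = (k ^+ 2)^-1 *: (2 * dot c a *: c) - a.
    by rewrite -exprVn; coords3; ring.
  by rewrite sqr_sqrtr ?ltW// cE scalerA mulVf ?gt_eqF// scale1r addrC addKr.
move=> a1 b1; have [ab|ab] := ltP 0 (dot (a + b) (a + b)).
  apply: (scaled (a + b)) => //; congr (_ *: _).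
  transitivity (dot (a + b) (a + b) + dot a a - dot b b); first by coords3; ring.
  by rewrite a1 b1 addrK.
have ba : a + b = 0.
  apply/rowP; move: ab; rewrite /dot ord3_sumE => ab.
  have s0 := sqr_ge0 ((a + b) 0 0); have s1 := sqr_ge0 ((a + b) 0 1).
  have s2 := sqr_ge0 ((a + b) 0 2).
  elim/ord3_ind; rewrite [RHS]mxE; apply/eqP; rewrite -sqrf_eq0;
    by apply/eqP; lra.
(* Antipodal case: the axis is the cross product of [a] with a basis vector that
   is not parallel to [a]. *)
have orth (e : 'rV[R]_3) : dot (cross a e) a = 0 by coords3; ring.
have ex i : a 0 i ^+ 2 < 1 -> exists2 u, dot u u = 1 & half_turn u a = b.
  move=> ai; apply: (scaled (cross a (delta_mx 0 i))) => //; last first.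
    by rewrite orth mulr0 scale0r ba scaler0.
  have -> : dot (cross a (delta_mx 0 i)) (cross a (delta_mx 0 i)) =
      dot a a * dot (delta_mx 0 i) (delta_mx 0 i) - dot a (delta_mx 0 i) ^+ 2.
    by move: (delta_mx 0 i) => d; coords3; ring.
  by rewrite !dot_delta mxE !eqxx mulr1 a1 subr_gt0.
have [a0|a0] := ltP (a 0 0 ^+ 2) 1; first exact: ex a0.
apply: (ex 1); move: a1; rewrite /dot ord3_sumE => a1.
have s2 := sqr_ge0 (a 0 2); lra.
Qed.

Definition half_turn_correction_mx {R : rcfType} (u : 'rV[R]_3) : 'M[R]_3 :=
  \matrix_i half_turn_correction u (delta_mx 0 i).

Lemma mul_half_turn_correction_mx (R : rcfType) (u a : 'rV[R]_3) :
  a *m half_turn_correction_mx u = half_turn_correction u a.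
Proof.
rewrite mulmx_sum_row ord3_sumE !rowK /half_turn_correction; coords3;
rewrite !(eqxx, ord3_eqE) /=; ring.
Qed.

(** * Almost contact metric 3-structures on a vector space *)

Section Evaluation.
Variables (K : numFieldType) (m : nat).
Implicit Types (w : 'cV[K]_m) (g G : 'M[K]_m) (u v : 'rV[K]_m) (k : K).

Lemma ev1D w u v : ev1 w (u + v) = ev1 w u + ev1 w v.
Proof. by rewrite /ev1 mulmxDl mxE. Qed.

Lemma ev1Z w k v : ev1 w (k *: v) = k * ev1 w v.
Proof. by rewrite /ev1 -scalemxAl mxE. Qed.

Lemma ev10 w : ev1 w 0 = 0.
Proof. by rewrite /ev1 mul0mx mxE. Qed.

Lemma ev2Dl g u u' v : ev2 g (u + u') v = ev2 g u v + ev2 g u' v.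
Proof. by rewrite /ev2 !mulmxDl mxE. Qed.

Lemma ev2Zl g k u v : ev2 g (k *: u) v = k * ev2 g u v.
Proof. by rewrite /ev2 -!scalemxAl mxE. Qed.

Lemma ev2Dr g u v v' : ev2 g u (v + v') = ev2 g u v + ev2 g u v'.
Proof. by rewrite /ev2 linearD mulmxDr mxE. Qed.

Lemma ev2Zr g k u v : ev2 g u (k *: v) = k * ev2 g u v.
Proof. by rewrite /ev2 linearZ -scalemxAr mxE. Qed.

Lemma ev2Nr g u v : ev2 g u (- v) = - ev2 g u v.
Proof. by rewrite -scaleN1r ev2Zr mulN1r. Qed.

Lemma applD G u v : appl G (u + v) = appl G u + appl G v.
Proof. exact: mulmxDl. Qed.

Lemma applZ G k v : appl G (k *: v) = k *: appl G v.
Proof. by rewrite /appl scalemxAl. Qed.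

Lemma applN G v : appl G (- v) = - appl G v.
Proof. by rewrite /appl mulNmx. Qed.

End Evaluation.

Section Linear3structure.
Variables (R : rcfType) (m : nat) (g : 'M[R]_m) (Phi : 'I_3 -> 'M[R]_m).
Variables (xi : 'I_3 -> 'rV[R]_m) (eta : 'I_3 -> 'cV[R]_m).

(** When the forms [eta] are dual to the vectors [xi], these are the coordinates of
    the component of [v] along the Reeb vectors. *)
Definition reeb_coords (v : 'rV[R]_m) : 'rV[R]_3 := \row_i ev1 (eta i) v.

(** What the axioms of an almost contact metric 3-structure say at one point, where
    only linear algebra is left. *)
Record linear_3structure : Prop := Linear3Structure {
  l3_sym : forall u v, ev2 g u v = ev2 g v u;
  l3_pos : forall v, v != 0 -> 0 < ev2 g v v;
  l3_sq : forall i v,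
    appl (Phi i) (appl (Phi i) v) = - v + ev1 (eta i) v *: xi i;
  l3_unit : forall i, ev1 (eta i) (xi i) = 1;
  l3_quat : forall i : 'I_3,
    [/\ forall v, appl (Phi i) (appl (Phi (i + 1)) v)
          - ev1 (eta (i + 1)) v *: xi i = appl (Phi (i + 2)) v,
        forall v, - appl (Phi (i + 1)) (appl (Phi i) v)
          + ev1 (eta i) v *: xi (i + 1) = appl (Phi (i + 2)) v,
        appl (Phi i) (xi (i + 1)) = xi (i + 2) /\
          - appl (Phi (i + 1)) (xi i) = xi (i + 2) &
        forall v, ev1 (eta i) (appl (Phi (i + 1)) v) = ev1 (eta (i + 2)) v /\
          - ev1 (eta (i + 1)) (appl (Phi i) v) = ev1 (eta (i + 2)) v];
  l3_dual : forall i v, ev2 g (xi i) v = ev1 (eta i) v;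
  l3_metric : forall i u v, ev2 g (appl (Phi i) u) (appl (Phi i) v) =
    ev2 g u v - ev1 (eta i) u * ev1 (eta i) v }.

Lemma appl_lin3 (a : 'rV[R]_3) v :
  appl (lin3 a Phi) v = lin3 a (fun i => appl (Phi i) v).
Proof.
by rewrite /appl mulmx_sumr; apply: eq_bigr => i _; rewrite scalemxAr.
Qed.

Lemma ev1_lin3 (a : 'rV[R]_3) v :
  ev1 (lin3 a eta) v = dot a (reeb_coords v).
Proof.
rewrite /ev1 mulmx_sumr summxE; apply: eq_bigr => i _.
by rewrite -scalemxAr [LHS]mxE [reeb_coords v _ _]mxE.
Qed.

Hypothesis H : linear_3structure.

(** For [j != i], [Phi_i] maps the other two Reeb vectors to each other up to sign,
    so that [Phi_i (Phi_i xi_j) = - xi_j]; comparing with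
    [Phi_i^2 = - 1 + eta_i xi_i] gives [eta_i xi_j = 0]. *)
Lemma reeb_dual i j : ev1 (eta i) (xi j) = (i == j)%:R.
Proof.
have off k : ev1 (eta k) (xi (k + 1)) = 0 /\ ev1 (eta k) (xi (k + 2)) = 0.
  have [_ _ [A _] _] := l3_quat H k.
  have [_ _ [_ B] _] := l3_quat H (k + 2).
  have kk : k + 2 + 1 = k by move: k {A B}; elim/ord3_ind; apply/val_inj.
  have kkk : k + 2 + 2 = k + 1.
    by move: k {A B kk}; elim/ord3_ind; apply/val_inj.
  rewrite kk kkk in B.
  have B' : appl (Phi k) (xi (k + 2)) = - xi (k + 1) by rewrite -B opprK.
  have z0 c : c *: xi k = 0 -> c = 0.
    by move/(congr1 (ev1 (eta k))); rewrite ev1Z l3_unit // mulr1 ev10.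
  split; apply: z0.
    have := l3_sq H k (xi (k + 1)); rewrite A B' => /eqP.
    by rewrite eq_sym -subr_eq0 opprK addrAC addNr add0r => /eqP.
  have := l3_sq H k (xi (k + 2)); rewrite B' applN A => /eqP.
  by rewrite eq_sym -subr_eq0 opprK addrAC addNr add0r => /eqP.
have U := l3_unit H.
have [r1 r2] := off 0; have [r3 r4] := off 1; have [r5 r6] := off 2.
rewrite !(add0r, ord3_addE) in r1 r2 r3 r4 r5 r6.
by move: i j; elim/ord3_ind; elim/ord3_ind;
  rewrite ?U ?r1 ?r2 ?r3 ?r4 ?r5 ?r6 ?eqxx ?ord3_eqE.
Qed.

(** [Phi_i xi_i] has length zero by compatibility of the metric. *)
Lemma endo_reeb i : appl (Phi i) (xi i) = 0.
Proof.
apply/eqP; apply: contraT => /(l3_pos H).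
by rewrite l3_metric // l3_dual // l3_unit // mulr1 subrr ltxx.
Qed.

(** Computing [Phi_i^3 v] in two ways shows that [eta_i (Phi_i v) xi_i] is equal to
    [eta_i v Phi_i xi_i], which is zero. *)
Lemma form_endo i v : ev1 (eta i) (appl (Phi i) v) = 0.
Proof.
have := congr1 (appl (Phi i)) (l3_sq H i v).
rewrite [LHS](l3_sq H i) applD applN applZ endo_reeb scaler0.
move/addrI/(congr1 (ev1 (eta i))).
by rewrite ev1Z l3_unit // mulr1 ev10.
Qed.

(** The products [Phi_i Phi_j] for fixed [i]; the two relations that involve
    [Phi_i Phi_(i+1)] and [Phi_i Phi_(i+2)] belong to the cyclic permutations
    starting at [i] and at [i + 2]. *)
Lemma endo_comp i v :
  [/\ appl (Phi i) (appl (Phi i) v) = - v + ev1 (eta i) v *: xi i,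
      appl (Phi i) (appl (Phi (i + 1)) v) =
        appl (Phi (i + 2)) v + ev1 (eta (i + 1)) v *: xi i &
      appl (Phi i) (appl (Phi (i + 2)) v) =
        - appl (Phi (i + 1)) v + ev1 (eta (i + 2)) v *: xi i].
Proof.
have [A _ _ _] := l3_quat H i; have [_ B _ _] := l3_quat H (i + 2).
have kk : i + 2 + 1 = i by move: i {A B}; elim/ord3_ind; apply/val_inj.
have kkk : i + 2 + 2 = i + 1.
  by move: i {A B kk}; elim/ord3_ind; apply/val_inj.
split; first exact: l3_sq.
  by rewrite -A subrK.
by rewrite -kkk -B kk opprD opprK -addrA addNr addr0.
Qed.

(** Quaternion multiplication, with a correction along the Reeb vectors. *)
Lemma endo_lin3_comp (a b : 'rV[R]_3) v :
  appl (lin3 a Phi) (appl (lin3 b Phi) v) =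
  - (dot a b *: v) + appl (lin3 (cross a b) Phi) v
  + dot b (reeb_coords v) *: lin3 a xi.
Proof.
rewrite !appl_lin3 !ord3_sumE !applD !applZ.
have [c00 c01 c02] := endo_comp 0 v; have [c11 c12 c10] := endo_comp 1 v.
have [c22 c20 c21] := endo_comp 2 v.
rewrite !(add0r, ord3_addE) in c01 c02 c12 c10 c20 c21.
rewrite c00 c01 c02 c11 c12 c10 c20 c21 c22.
move: (appl (Phi 0) v) (appl (Phi 1) v) (appl (Phi 2) v) => A B C.
rewrite /dot !ord3_sumE ![reeb_coords v _ _]mxE.
move: (ev1 (eta 0) v) (ev1 (eta 1) v) (ev1 (eta 2) v) => x y t.
by apply/rowP => k; rewrite !(mxE, add0r, ord3_addE); ring.
Qed.

Lemma endo_reeb_lin3 (a b : 'rV[R]_3) :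
  appl (lin3 a Phi) (lin3 b xi) = lin3 (cross a b) xi.
Proof.
have FZ i : [/\ appl (Phi i) (xi i) = 0, appl (Phi i) (xi (i + 1)) = xi (i + 2) &
    appl (Phi (i + 1)) (xi i) = - xi (i + 2)].
  have [_ _ [A B] _] := l3_quat H i.
  by split; [exact: endo_reeb | exact: A | rewrite -B opprK].
rewrite appl_lin3 !ord3_sumE !applD !applZ.
have [c00 c01 c10] := FZ 0; have [c11 c12 c21] := FZ 1.
have [c22 c20 c02] := FZ 2.
rewrite !(add0r, ord3_addE) in c01 c02 c12 c10 c20 c21.
rewrite c00 c01 c02 c11 c12 c10 c20 c21 c22.
by apply/rowP => k; rewrite !(mxE, add0r, ord3_addE); ring.
Qed.

Lemma reeb_coords_endo (a : 'rV[R]_3) v :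
  reeb_coords (appl (lin3 a Phi) v) = cross a (reeb_coords v).
Proof.
have EF i : [/\ ev1 (eta i) (appl (Phi i) v) = 0,
    ev1 (eta i) (appl (Phi (i + 1)) v) = ev1 (eta (i + 2)) v &
    ev1 (eta (i + 1)) (appl (Phi i) v) = - ev1 (eta (i + 2)) v].
  have [_ _ _ /(_ v)[A B]] := l3_quat H i.
  by split; [exact: form_endo | exact: A | rewrite -B opprK].
have [c00 c01 c10] := EF 0; have [c11 c12 c21] := EF 1.
have [c22 c20 c02] := EF 2.
rewrite !(add0r, ord3_addE) in c01 c02 c12 c10 c20 c21.
apply/rowP; elim/ord3_ind; rewrite [LHS]mxE [RHS]mxE !(add0r, ord3_addE);
  rewrite ![reeb_coords v _ _]mxE appl_lin3 !ord3_sumE !ev1D !ev1Z;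
  rewrite !(c00, c01, c02, c11, c12, c10, c20, c21, c22); ring.
Qed.

Lemma reeb_coords_lin3 (a : 'rV[R]_3) : reeb_coords (lin3 a xi) = a.
Proof.
apply/rowP => i; rewrite mxE ord3_sumE !ev1D !ev1Z !reeb_dual.
by move: i; elim/ord3_ind;
  rewrite !(eqxx, ord3_eqE, mulr1, mulr0, addr0, add0r).
Qed.

Lemma reeb_coordsD u v : reeb_coords (u + v) = reeb_coords u + reeb_coords v.
Proof. by apply/rowP => i; rewrite !mxE ev1D. Qed.

Lemma ev2_reeb_lin3 (a : 'rV[R]_3) v :
  ev2 g (lin3 a xi) v = dot a (reeb_coords v).
Proof.
rewrite !ord3_sumE !ev2Dl !ev2Zl !l3_dual // /dot ord3_sumE.
by rewrite ![reeb_coords v _ _]mxE.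
Qed.

(** Replace [v] by [Phi_i v] in the compatibility of [g] with [Phi_i]: the
    correction terms vanish because [eta_i (Phi_i v) = 0]. *)
Lemma endo_skew (a : 'rV[R]_3) u v :
  ev2 g (appl (lin3 a Phi) u) v = - ev2 g u (appl (lin3 a Phi) v).
Proof.
have sk i : ev2 g (appl (Phi i) u) v = - ev2 g u (appl (Phi i) v).
  have := l3_metric H i u (appl (Phi i) v).
  rewrite form_endo mulr0 subr0 => <-.
  rewrite l3_sq // ev2Dr ev2Zr ev2Nr opprD opprK.
  by rewrite [ev2 g _ (xi i)]l3_sym // l3_dual // form_endo mulr0 subr0.
rewrite !appl_lin3 !ord3_sumE !ev2Dl !ev2Zl !ev2Dr !ev2Zr !sk; ring.
Qed.

Lemma endo_metric (a : 'rV[R]_3) u v :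
  ev2 g (appl (lin3 a Phi) u) (appl (lin3 a Phi) v) =
  dot a a * ev2 g u v - dot a (reeb_coords u) * dot a (reeb_coords v).
Proof.
rewrite endo_skew endo_lin3_comp crossvv.
have -> : lin3 (0 : 'rV[R]_3) Phi = 0.
  by apply: big1 => i _; rewrite mxE scale0r.
rewrite /appl mulmx0 addr0 ev2Dr ev2Nr !ev2Zr [ev2 g u (\sum_i _)]l3_sym //.
by rewrite ev2_reeb_lin3 opprD opprK [_ * dot a (reeb_coords u)]mulrC.
Qed.

(** [Phi_u] on the horizontal part and the half-turn about [u] on the span of the
    Reeb vectors. *)
Definition half_turn_map (u : 'rV[R]_3) : 'M[R]_m :=
  lin3 u Phi
  + (\matrix_(k, i) eta i k 0) *m half_turn_correction_mx u *m (\matrix_i xi i).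

Lemma half_turn_mapE u v : v *m half_turn_map u =
  appl (lin3 u Phi) v + lin3 (half_turn_correction u (reeb_coords v)) xi.
Proof.
rewrite mulmxDr !mulmxA; congr (_ + _).
have -> : v *m (\matrix_(k, i) eta i k 0) = reeb_coords v.
  apply/rowP => i; rewrite !mxE /ev1 mxE.
  by apply: eq_bigr => k _; rewrite mxE.
rewrite mul_half_turn_correction_mx mulmx_sum_row.
by apply: eq_bigr => i _; rewrite rowK.
Qed.

Lemma reeb_coords_half_turn u v :
  reeb_coords (v *m half_turn_map u) = half_turn u (reeb_coords v).
Proof.
by rewrite half_turn_mapE reeb_coordsD reeb_coords_endo reeb_coords_lin3
  addrC subrK.
Qed.

(** On the horizontal part this is the quaternion identity [s' u = u s] for
    [s' = 2 <u, s> u - s], the conjugate of [s] by [u]. *)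
Lemma half_turn_endo u s v : dot u u = 1 ->
  appl (lin3 (half_turn u s) Phi) (v *m half_turn_map u) =
  appl (lin3 s Phi) v *m half_turn_map u.
Proof.
move=> u1; rewrite !half_turn_mapE applD endo_reeb_lin3 !endo_lin3_comp.
rewrite reeb_coords_endo -!lin3Z -[LHS]addrA -[RHS]addrA -!lin3D.
rewrite half_turn_correction_cross //; congr (- _ + appl _ _ + _).
  by rewrite half_turn_dot half_turn_axis // dotC.
apply: eq_bigr => i _; congr (_ *: _).
have -> // : cross (half_turn u s) u = cross u s.
by coords3; ring.
Qed.

Lemma half_turn_isometry u v w : dot u u = 1 ->
  ev2 g (v *m half_turn_map u) (w *m half_turn_map u) = ev2 g v w.
Proof.
move=> u1; rewrite !half_turn_mapE ev2Dl !ev2Dr endo_metric u1 mul1r.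
rewrite [ev2 g (appl _ _) (\sum_i _)]l3_sym // !ev2_reeb_lin3.
rewrite reeb_coords_lin3 !reeb_coords_endo.
have := half_turn_correction_dot (reeb_coords v) (reeb_coords w) u1.
set A := dot _ _; set B := dot _ _; set C := dot _ _ => ABC.
lra.
Qed.

Definition fundamental_form (s : 'rV[R]_3) (u v : 'rV[R]_m) : R :=
  ev2 g (appl (lin3 s Phi) u) v.

Lemma half_turn_form u s v : dot u u = 1 ->
  ev1 (lin3 (half_turn u s) eta) (v *m half_turn_map u) =
  ev1 (lin3 s eta) v.
Proof.
by move=> u1; rewrite !ev1_lin3 reeb_coords_half_turn half_turn_dot half_turnK.
Qed.

Lemma half_turn_fundamental_form u s v w : dot u u = 1 ->
  fundamental_form (half_turn u s) (v *m half_turn_map u) (w *m half_turn_map u)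
  = fundamental_form s v w.
Proof.
by move=> u1; rewrite /fundamental_form half_turn_endo // half_turn_isometry.
Qed.

(** * The volume forms of the rotated structures *)

Section Volume.
Variable k : nat.
Hypothesis dim_eq : (1 + k * 2)%N = m.

Local Notation volume s :=
  (form1_wedge_pow (ev1 (lin3 s eta)) (fundamental_form s) k).

Lemma volume_pullback (s : 'rV[R]_3) (T : 'M[R]_m) v :
  volume s (fun i => v i *m T) = \det T * volume s v.
Proof.
apply: (top_form_pullback dim_eq); last exact: wedge_alternating.
have -> : fundamental_form s = ev2 (lin3 s Phi *m g).
  by apply/funext => u; apply/funext => w; rewrite /ev2 mulmxA.
exact: form1_wedge_pow_multilinear.
Qed.

Lemma volume_half_turn (u s : 'rV[R]_3) v : dot u u = 1 ->
  volume (half_turn u s) (fun i => v i *m half_turn_map u) = volume s v.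
Proof.
move=> u1; rewrite (form1_wedge_pow_comp (fun x => x *m half_turn_map u)).
have -> : (fun x => ev1 (lin3 (half_turn u s) eta) (x *m half_turn_map u)) =
    ev1 (lin3 s eta) by apply/funext => x; exact: half_turn_form.
have -> // : (fun x y => fundamental_form (half_turn u s)
    (x *m half_turn_map u) (y *m half_turn_map u)) = fundamental_form s.
by apply/funext => x; apply/funext => y; exact: half_turn_fundamental_form.
Qed.

Lemma volume_neq0 (s s' : 'rV[R]_3) : dot s s = 1 -> dot s' s' = 1 ->
  (exists v, volume s v != 0) -> exists v, volume s' v != 0.
Proof.
move=> s1 s'1 [v v0]; have [u u1 us] := half_turn_exists s1 s'1.
exists (fun i => v i *m half_turn_map u).
by rewrite -us volume_half_turn.
Qed.

(** The half-turn about [u] fixes [u], so [half_turn_map u] preserves the volume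
    form attached to [u] itself. *)
Lemma det_half_turn_map (u : 'rV[R]_3) :
  dot u u = 1 -> (exists v, volume u v != 0) ->
  \det (half_turn_map u) = 1.
Proof.
move=> u1 [v v0]; apply: (mulIf v0); rewrite mul1r -volume_pullback.
by have := volume_half_turn u v u1; rewrite half_turn_axis.
Qed.

Lemma volume_eq (s s' : 'rV[R]_3) v : dot s s = 1 -> dot s' s' = 1 ->
  (exists v, volume s v != 0) -> volume s v = volume s' v.
Proof.
move=> s1 s'1 s0; have [u u1 us] := half_turn_exists s1 s'1.
rewrite -(volume_half_turn s v u1) us volume_pullback.
by rewrite det_half_turn_map ?mul1r//; exact: volume_neq0 s0.
Qed.

End Volume.

End Linear3structure.

(** * Structures on a manifold *)

Lemma linear_3structure_at (R : realType) (m : nat) (M : Type) (A : atlas R m M)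
    (Phi : 'I_3 -> field_endo A) (xi : 'I_3 -> field_vec A)
    (eta : 'I_3 -> field_covec A) (g : field_bilin A) :
  almost_contact_metric_3structure Phi xi eta g ->
  forall a x, cdom a x ->
  linear_3structure (g a x) (fun i => Phi i a x) (fun i => xi i a x)
    (fun i => eta i a x).
Proof.
case=> [[ac q] [_ _ sym pos] cm] a x ax; split.
- exact: sym.
- exact: pos.
- by move=> i v; have [_ _ _ sq _] := ac i; exact: sq.
- by move=> i; have [_ _ _ _ unit] := ac i; exact: unit.
- by move=> i; exact: q.
- by move=> i v; have [dual _] := cm i a x ax; exact: dual.
- by move=> i u v; have [_ metric] := cm i a x ax; exact: metric.
Qed.

Lemma almost_contact_metric_lin3 (R : realType) (m : nat) (M : Type)
    (A : atlas R m M) (Phi : 'I_3 -> field_endo A) (xi : 'I_3 -> field_vec A)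
    (eta : 'I_3 -> field_covec A) (g : field_bilin A) (s : 'rV[R]_3) :
  (forall a : cidx A, open (cdom a)) ->
  almost_contact_metric_3structure Phi xi eta g -> dot s s = 1 ->
  almost_contact_metric g (lin3_endo s Phi) (lin3_vec s xi) (lin3_covec s eta).
Proof.
move=> oA st s1; have [[ac _] rg _] := st.
split=> //; first split.
- split=> [a|a b x abx].
    by apply: smooth_on_lincomb => // i; have [[]] := ac i.
  rewrite mulmx_suml mulmx_sumr; apply: eq_bigr => i _.
  rewrite -scalemxAl -scalemxAr; congr (_ *: _).
  by have [[_ compat] _ _ _ _] := ac i; exact: compat.
- split=> [a|a b x abx].
    by apply: smooth_on_lincomb => // i; have [_ []] := ac i.
  rewrite mulmx_suml; apply: eq_bigr => i _.
  rewrite -scalemxAl; congr (_ *: _).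
  by have [_ [_ compat] _ _ _] := ac i; exact: compat.
- split=> [a|a b x abx Ux].
    by apply: smooth_on_lincomb => // i; have [_ _ []] := ac i.
  rewrite mulmx_sumr; apply: eq_bigr => i _.
  rewrite -scalemxAr; congr (_ *: _).
  by have [_ _ [_ compat] _ _] := ac i; exact: compat.
- move=> a x ax v; have H := linear_3structure_at st ax.
  rewrite (endo_lin3_comp H) s1 scale1r crossvv ev1_lin3.
  by rewrite big1 /appl ?mulmx0 ?addr0 // => i _; rewrite mxE scale0r.
- move=> a x ax; have H := linear_3structure_at st ax.
  by rewrite ev1_lin3 (reeb_coords_lin3 H).
- move=> a x ax; have H := linear_3structure_at st ax.
  split=> [v|u v]; first by rewrite (ev2_reeb_lin3 H) ev1_lin3.
  by rewrite (endo_metric H) s1 mul1r !ev1_lin3.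
Qed.

Theorem corollary1 (R : realType) (n : nat) (hn : (0 < n)%N)
    (Z : complexContactManifold R n) (h : hermitianStructure Z)
    (gQ : field_bilin (circle_atlas h))
    (Phi : 'I_3 -> field_endo (circle_atlas h))
    (xi : 'I_3 -> field_vec (circle_atlas h))
    (eta : 'I_3 -> field_covec (circle_atlas h))
    (hQ : associated_structure gQ Phi xi eta) :
  (forall s : 'rV[R]_3, unit_sphere s ->
     almost_contact_metric gQ (lin3_endo s Phi) (lin3_vec s xi)
       (lin3_covec s eta)) /\
  (forall s s' : 'rV[R]_3, unit_sphere s -> unit_sphere s' ->
     forall (e : cidx (circle_atlas h)) (x : 'rV[R]_(1 + (n.*2.+1 + n.*2.+1))),
       cdom e x ->
       (forall v : 'I_(1 + n.*2.+1 * 2) -> 'rV[R]_(1 + (n.*2.+1 + n.*2.+1)),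
          fundamental_volume gQ (lin3_endo s Phi) (lin3_covec s eta) n.*2.+1 e x v =
          fundamental_volume gQ (lin3_endo s' Phi) (lin3_covec s' eta) n.*2.+1 e x v) /\
       (exists v : 'I_(1 + n.*2.+1 * 2) -> 'rV[R]_(1 + (n.*2.+1 + n.*2.+1)),
          fundamental_volume gQ (lin3_endo s Phi) (lin3_covec s eta) n.*2.+1 e x v != 0)).
Proof.
have unitE (s : 'rV[R]_3) : unit_sphere s -> dot s s = 1.
  by move=> s1; rewrite -[RHS]s1; apply: eq_bigr => i _; rewrite expr2.
have st := as_3structure hQ.
split=> [s /unitE s1 | s s' /unitE s1 /unitE s'1 e x ex].
  exact: almost_contact_metric_lin3 (open_circle_chart (h := h)) st s1.
have H := linear_3structure_at st ex.
(* Both sides are the real dimension [4 n + 3] of the circle bundle. *)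
have dim_eq : (1 + n.*2.+1 * 2 = 1 + (n.*2.+1 + n.*2.+1))%N.
  by rewrite muln2 addnn.
(* The second of the three structures, whose contact form is the real part of
   [vartheta]. *)
pose d : 'rV[R]_3 := delta_mx 0 1.
have d1 : dot d d = 1 by rewrite dot_delta mxE !eqxx.
have d_neq0 : exists v, fundamental_volume gQ (lin3_endo d Phi)
    (lin3_covec d eta) n.*2.+1 e x v != 0.
  have [_ /(_ e x ex)[v v0]] := as_contact2 hQ; exists v.
  have [_ _ _ _ /(_ e x ex)[_ _ dE]] := as_contact_metric2 hQ.
  move: v0; rewrite /contact_volume /fundamental_volume /lin3_covec /lin3_endo.
  have -> : dext (eta 1 e) x = fun u w => ev2 (gQ e x) (appl (Phi 1 e x) u) w.
    by apply/funext => u; apply/funext => w; exact: dE.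
  by rewrite !lin3_delta.
have s_neq0 := volume_neq0 H d1 s1 d_neq0.
by split=> [v|]; [exact: (volume_eq H dim_eq v s1 s'1) | exact: s_neq0].
Qed.
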